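(* Let $p$ be a prime and let $(A,+,\cdot)$ be a nilpotent pre-Lie algebra over $\mathbb{F}_p$ of cardinality $p^5$. Then $A^{[8]}=0$.
   Context: A pre-Lie algebra over $\mathbb{F}_p$ is an $\mathbb{F}_p$-vector space $A$ with a bilinear product $\cdot$ satisfying $(a\cdot b)\cdot c-a\cdot(b\cdot c)=(b\cdot a)\cdot c-b\cdot(a\cdot c)$ for all $a,b,c\in A$. It is nilpotent if for some $n\in\mathbb{N}$ every product of $n$ elements (in any bracketing) is zero. For subspaces $B,C\subseteq A$, $B\cdot C$ denotes the additive subgroup (equivalently, subspace) spanned by all $b\cdot c$ with $b\in B$, $c\in C$. Define $A^{[1]}=A$ and $A^{[i+1]}=\sum_{j=1}^{i}A^{[j]}\cdot A^{[i+1-j]}$ for $i\ge 1$. *)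

(* Defs.v *)
From HB Require Import structures.
From mathcomp Require Import all_boot all_order all_algebra all_field.

Set Implicit Arguments.
Unset Strict Implicit.
Unset Printing Implicit Defensive.

Import GRing.Theory.
Local Open Scope ring_scope.

Inductive bracketing (T : Type) : Type :=
| BLeaf of T
| BNode of bracketing T & bracketing T.

Fixpoint bsize (T : Type) (t : bracketing T) : nat :=
  match t with
  | BLeaf _ => 1
  | BNode t1 t2 => bsize t1 + bsize t2
  end.

Fixpoint beval (T : Type) (op : T -> T -> T) (t : bracketing T) : T :=
  match t with
  | BLeaf x => x
  | BNode t1 t2 => op (beval op t1) (beval op t2)
  end.

Section PreLie.

Variables (F : finFieldType) (A : vectType F).

Definition pre_lie (mul : A -> A -> A) : Prop :=
  forall a b c : A,
    mul (mul a b) c - mul a (mul b c) = mul (mul b a) c - mul b (mul a c).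

(* A product of n elements needs n >= 1: no bracketing has size 0, so without
   this bound the case n = 0 would make the property vacuous. *)
Definition nilpotent_mul (mul : A -> A -> A) : Prop :=
  exists2 n : nat, (0 < n)%N &
    forall t : bracketing A, bsize t = n -> beval mul t = 0.

(* [finvect_type A] is A with its finite type structure, so that the lists
   below enumerate all the elements of B and of C. *)
Definition mulv (mul : A -> A -> A) (B C : {vspace A}) : {vspace A} :=
  <<[seq mul b c | b <- enum [pred x : finvect_type A | x \in B],
                   c <- enum [pred x : finvect_type A | x \in C]]>>%VS.

(* The list A^[1], ..., A^[n]; the term A^[j] has index j.-1 in it. *)
Fixpoint dpow_seq (mul : A -> A -> A) (n : nat) : seq {vspace A} :=
  if n is i.+1 then
    let s := dpow_seq mul i in
    rcons s (if i == 0%N then fullv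
             else \sum_(1 <= j < i.+1)
                    mulv mul (nth 0%VS s j.-1) (nth 0%VS s (i - j)))%VS
  else [::].

(* A^[n], for n >= 1 (the junk value at n = 0 is the zero subspace);
   characterized by [dpow1] and [dpowS]. *)
Definition dpow (mul : A -> A -> A) (n : nat) : {vspace A} :=
  if n is i.+1 then nth 0%VS (dpow_seq mul n) i else 0%VS.

Lemma mulvP (mul : A -> A -> A) (B C D : {vspace A}) :
  reflect (forall b c, b \in B -> c \in C -> mul b c \in D)
          (mulv mul B C <= D)%VS.
Proof.
have memE (V : {vspace A}) (x : A) :
    (x \in (enum [pred y : finvect_type A | y \in V] : seq A)) =
    (x \in V).
  exact: (mem_enum [pred y : finvect_type A | y \in V]).
apply: (iffP span_subvP) => [sBC b c Bb Cc | sBC v].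
  apply: sBC; apply/allpairsP; exists (b, c).
  by split; rewrite ?memE.
by case/allpairsP=> -[b c] /= [Bb Cc ->]; apply: sBC; rewrite -memE.
Qed.

Lemma size_dpow_seq (mul : A -> A -> A) (n : nat) :
  size (dpow_seq mul n) = n.
Proof. by elim: n => //= n IHn; rewrite size_rcons IHn. Qed.

Lemma nth_dpow_seq (mul : A -> A -> A) (n i : nat) :
  (i < n)%N -> nth 0%VS (dpow_seq mul n) i = dpow mul i.+1.
Proof.
elim: n => // n IHn; rewrite ltnS leq_eqVlt => /predU1P[-> // | lt_in].
by rewrite /= nth_rcons size_dpow_seq lt_in IHn.
Qed.

Lemma dpow1 (mul : A -> A -> A) : dpow mul 1 = fullv.
Proof. by []. Qed.

Lemma dpowS (mul : A -> A -> A) (i : nat) : (0 < i)%N ->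
  dpow mul i.+1 =
    (\sum_(1 <= j < i.+1) mulv mul (dpow mul j) (dpow mul (i.+1 - j)))%VS.
Proof.
move=> i_gt0; rewrite /dpow /= nth_rcons size_dpow_seq ltnn eqxx.
rewrite eqn0Ngt i_gt0 /= !big_nat; apply: eq_bigr => -[//|j] /andP[_ le_ji].
rewrite ltnS in le_ji; rewrite subSS -(subnSK le_ji) /= !nth_dpow_seq //.
by rewrite subnSK // leq_subr.
Qed.

End PreLie.

(* Main.v *)
Require Import Defs.
From mathcomp Require Import all_boot all_order all_algebra all_field.
From mathcomp Require Import zify.

(** Write V n for the descending power A^[n] of the algebra A. Since V is
    decreasing and V i * V j lies in V (i + j), there is an associated graded
    algebra gr A, whose component of degree n is V n / V (n + 1), and gr A is
    generated by its component of degree 1, because V n is by construction the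
    sum of the products V i * V j with i + j = n. Call n a jump if the component
    of degree n is nonzero. An algebra of dimension 5 has at most 5 jumps
    ([size_jumps]), and by nilpotency V 8 is zero unless there is a jump m >= 8
    ([dpow_eq0_or_jump]). So the proof is about which sets of degrees can
    support gr A.

    Two constraints are used. As gr A is generated in degree 1, a jump n > 1 is
    the sum of two jumps i, j whose product is nonzero in gr A
    ([vanish_njump]); hence a jump m >= q forces a jump between q and 2q - 2
    ([jump_between]). Secondly, the pre-Lie identity can be read as
      a (w z) = (a w) z - (w a) z + w (a z),
    and for w of degree k and z of degree l all the terms on the right contain
    a product of degree i + k or i + l, where i is the degree of a. So the
    products of degrees i and j vanish in gr A as soon as there is no jump
    strictly between i and i + j ([vanish_gap]).

    Suppose that m >= 8 is a jump. The first constraint gives the jumps 1 and 2,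
    a jump among 3, 4, and one among 4, 5, 6. Without the jump 3 the only way to
    reach 4 is 2 + 2, which the gap at 3 kills; without 4 and 5 the only way to
    reach 6 is 3 + 3, which the gap at 4, 5 kills. So the jumps are exactly
    1, 2, 3, q, m with q = 4 or 5, and m is one of
      4 + 4 for q = 4, and 5 + 5, 5 + 3 or 3 + 5 for q = 5.
    All but the last vanish by the gap argument. For 3 + 5, degree 5 is spanned
    by the products of degrees 2 + 3 and 3 + 2 as 4 is no jump; the latter
    vanish by the gap at 4, and for the former the pre-Lie identity brings
    3 + 5 back to 5 + 3 and to degree 6, both of which vanish. *)

Import GRing.Theory.
Local Open Scope ring_scope.

(** * The descending powers of a bilinear product *)

Section DescendingPowers.

Set Implicit Arguments.
Unset Strict Implicit.

Context {F : finFieldType} {A : vectType F}.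
Variable mul : {bilinear A -> A -> A}.

Local Notation V := (dpow mul).

(** The linear map f is there to be specialized to a left multiplication: to
    bound a * V n it is enough to bound the elements a * (b * c). *)
Lemma memv_linear_dpow (f : {linear A -> A}) (U : {vspace A}) n : (1 < n)%N ->
    (forall i j, (0 < i)%N -> (0 < j)%N -> (i + j = n)%N ->
       forall b c, b \in V i -> c \in V j -> f (mul b c) \in U) ->
  forall x, x \in V n -> f x \in U.
Proof.
case: n => [|n] // n_gt0 fU x Vx.
rewrite -(lfunE f) memv_preim; move: x Vx; apply/subvP.
rewrite dpowS // big_seq; elim/big_ind: _ => [|X Y sXU sYU|i].
- exact: sub0v.
- by rewrite subv_add sXU.
- rewrite mem_index_iota => /andP[i_gt0 lt_in].
  apply/mulvP => b c Vb Vc; rewrite -memv_preim lfunE.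
  by apply: (fU i (n.+1 - i)%N) => //; lia.
Qed.

Lemma dpow_subv U n : (1 < n)%N ->
    (forall i j, (0 < i)%N -> (0 < j)%N -> (i + j = n)%N ->
       (mulv mul (V i) (V j) <= U)%VS) ->
  (V n <= U)%VS.
Proof.
move=> n_gt1 sVU; apply/subvP; apply: (@memv_linear_dpow idfun) => //= i j.
by move=> i0 j0 ijn b c; move/mulvP: (sVU i j i0 j0 ijn); apply.
Qed.

Lemma mulv_dpow i j : (0 < i)%N -> (0 < j)%N ->
  (mulv mul (V i) (V j) <= V (i + j))%VS.
Proof.
case: i => // i _ j_gt0; rewrite addSn [V (i + j).+1]dpowS; last by lia.
rewrite (bigD1_seq i.+1) ?iota_uniq ?mem_index_iota //=; last by lia.
by rewrite subSS addKn addvSl.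
Qed.

Lemma mem_mul_dpow i j b c : (0 < i)%N -> (0 < j)%N ->
  b \in V i -> c \in V j -> mul b c \in V (i + j).
Proof. by move=> i0 j0; move/mulvP: (mulv_dpow i0 j0); apply. Qed.

(** In a product of degrees i + j = n + 1 >= 3 one factor has degree at least 2,
    and by induction it may be regarded as having degree one less. *)
Lemma dpowS_subv n : (0 < n)%N -> (V n.+1 <= V n)%VS.
Proof.
elim/ltn_ind: n => -[|[|n]] // IHn _; first exact: subvf.
apply: dpow_subv => // i j i0 j0 ijn; apply/mulvP => b c Vb Vc.
have [i_gt1 | i_le1] := ltnP 1 i.
- have -> : n.+2 = (i.-1 + j)%N by lia.
  apply: mem_mul_dpow => //; first by lia.
  by apply: (subvP (IHn i.-1 _ _)); rewrite ?prednK; lia.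
- have -> : n.+2 = (i + j.-1)%N by lia.
  apply: mem_mul_dpow => //; first by lia.
  by apply: (subvP (IHn j.-1 _ _)); rewrite ?prednK; lia.
Qed.

(** V n is spanned by the bracketed products of n elements; stating this as an
    inclusion in every U containing them lets U be replaced by its preimages
    under left and right multiplications in the induction. *)
Lemma dpow_bracketing_subv n (U : {vspace A}) : (0 < n)%N ->
    (forall t : bracketing A, bsize t = n -> beval mul t \in U) ->
  (V n <= U)%VS.
Proof.
elim/ltn_ind: n U => -[|[|n]] // IHn U _ tU.
  by apply/subvP => x _; apply: (tU (BLeaf x)).
apply: dpow_subv => // i j i0 j0 ijn; apply/mulvP => b c Vb Vc.
rewrite -[mul b c](lfunE (mul b)) memv_preim.
move: c Vc; apply/subvP/IHn => [||t2 t2j]; [lia | lia |].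
rewrite -memv_preim lfunE; change (applyr mul (beval mul t2) b \in U).
rewrite -(lfunE (applyr mul (beval mul t2))) memv_preim.
move: b Vb; apply/subvP/IHn => [||t1 t1i]; [lia | lia |].
by rewrite -memv_preim lfunE; apply: (tU (BNode t1 t2)); rewrite /= t1i t2j.
Qed.

Lemma nilpotent_dpow :
  nilpotent_mul mul -> exists2 n, (0 < n)%N & V n = 0%VS.
Proof.
case=> n n0 nil; exists n => //; apply/eqP; rewrite -subv0.
by apply: dpow_bracketing_subv => // t /nil->; apply: mem0v.
Qed.

(** * Jumps and vanishing products in the associated graded algebra *)

(** The degree n component V n / V (n + 1) of gr A is nonzero. The case n = 0 is
    excluded because V 0 is the zero subspace rather than A. *)
Definition jump n := (0 < n)%N && ~~ (V n <= V n.+1)%VS.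

(** The product of the components of degrees i and j of gr A is zero. *)
Definition vanish i j := (mulv mul (V i) (V j) <= V (i + j).+1)%VS.

(** The dimension of V drops by at least one at each jump. *)
Lemma sum_jump_dim n :
  (\sum_(1 <= i < n.+1) jump i + \dim (V n.+1) <= \dim {:A})%N.
Proof.
elim: n => [|n IHn]; first by rewrite big_geq.
rewrite big_nat_recr // -addnA; apply: leq_trans IHn; rewrite leq_add2l.
have sVV := @dpowS_subv n.+1 isT.
rewrite /jump andTb; case: (boolP (V n.+1 <= V n.+2)%VS) => [|nsVV].
  by move=> _; exact: dimvS.
rewrite add1n ltnNge; apply: contra nsVV => le_dim.
by have /eqP-> : V n.+2 == V n.+1 by rewrite eqEdim sVV.
Qed.

Lemma size_jumps s : uniq s -> all jump s -> (size s <= \dim {:A})%N.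
Proof.
move=> s_uniq /allP s_jump.
pose N := \max_(i <- s) i; apply: leq_trans (sum_jump_dim N).
apply: leq_trans (leq_addr _ _).
rewrite -big_mkcond /= sum1_count -size_filter.
apply: uniq_leq_size => // i si; rewrite mem_filter s_jump // mem_index_iota.
have /andP[-> _] := s_jump i si.
by rewrite ltnS /N; apply: (leq_bigmax_seq (F := id)).
Qed.

(** If no m >= n is a jump then V is constant from n on, hence zero. *)
Lemma dpow_eq0_or_jump n : nilpotent_mul mul -> (0 < n)%N ->
  V n = 0%VS \/ exists2 m, (n <= m)%N & jump m.
Proof.
case/nilpotent_dpow=> N N0 VN0 n0.
have [le_nN | lt_Nn] := leqP n N; last first.
  left; apply/eqP; rewrite -subv0 -VN0 -(subnK (ltnW lt_Nn)).
  elim: (n - N)%N => // k IHk; rewrite addSn.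
  by apply: subv_trans IHk; apply: dpowS_subv; lia.
move: (N - n)%N (subnK le_nN) => d.
elim: d n n0 {le_nN} => [|d IHd] n n0 dn.
  by left; rewrite -VN0 -dn.
have [jn | njn] := boolP (jump n); first by right; exists n.
have [||Vn0|[m lt_nm jm]] := IHd n.+1; [lia | lia | left | right]; last first.
  by exists m => //; apply: ltnW.
by move: njn; rewrite /jump n0 Vn0 negbK subv0 => /eqP.
Qed.

Lemma vanish_njumpl i j : (0 < i)%N -> (0 < j)%N -> ~~ jump i -> vanish i j.
Proof.
rewrite /jump => i0 j0; rewrite i0 negbK => /subvP sV.
apply/mulvP => b c /sV Vb Vc; rewrite -addSn; exact: mem_mul_dpow.
Qed.

Lemma vanish_njumpr i j : (0 < i)%N -> (0 < j)%N -> ~~ jump j -> vanish i j.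
Proof.
rewrite /jump => i0 j0; rewrite j0 negbK => /subvP sV.
apply/mulvP => b c Vb /sV Vc; rewrite -addnS; exact: mem_mul_dpow.
Qed.

Lemma vanish_njump n : (1 < n)%N ->
    (forall i j, (0 < i)%N -> (0 < j)%N -> (i + j = n)%N ->
       jump i -> jump j -> vanish i j) ->
  ~~ jump n.
Proof.
move=> n_gt1 van; rewrite /jump (ltnW n_gt1) negbK.
apply: dpow_subv => // i j i0 j0 ijn.
rewrite -ijn -/(vanish i j).
have [ji|] := boolP (jump i); last exact: vanish_njumpl.
have [jj|] := boolP (jump j); last exact: vanish_njumpr.
exact: van.
Qed.

(** Without jumps in the range q, ..., 2q - 2 there is none beyond q: the jumps
    below q are at most q - 1, so their sums do not go past 2q - 2. *)
Lemma jump_between q m : (1 < q)%N -> (q <= m)%N -> jump m ->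
  has jump (iota q q.-1).
Proof.
move=> q1 le_qm; apply: contraTT => /hasPn no_jump.
elim/ltn_ind: m le_qm => m IHm le_qm.
have [lt_m|le_m] := ltnP m (q + q.-1).
  by apply: no_jump; rewrite mem_iota le_qm.
apply: vanish_njump => [|i j i0 j0 ijm ji jj]; first by lia.
have [le_qi|lt_iq] := leqP q i.
  by move: ji; rewrite (negPf (IHm i _ _)) //; lia.
by move: jj; rewrite (negPf (IHm j _ _)) //; lia.
Qed.

Lemma jump1_of_jump2 : jump 2 -> jump 1.
Proof.
apply: contraTT => nj1; apply: vanish_njump => // i j i0 j0 ij ji _.
by move: ji; have -> : i = 1%N; [lia | rewrite (negPf nj1)].
Qed.

(** * The effect of the pre-Lie identity *)

Section PreLie.

Hypothesis mul_pre_lie : pre_lie mul.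

Lemma pre_lie_mulA a w z :
  mul a (mul w z) = mul (mul a w) z - mul (mul w a) z + mul w (mul a z).
Proof. by rewrite -addrA [- _ + _]addrC -opprB -mul_pre_lie subKr. Qed.

(** V j is spanned by the products w z of degrees k + l = j. Either w z already
    lies in V (j + 1), or [pre_lie_mulA] moves the factor a of degree i next to
    w and next to z. *)
Lemma vanish_pre_lie i j : (0 < i)%N -> (1 < j)%N ->
    (forall k l, (0 < k)%N -> (0 < l)%N -> (k + l = j)%N ->
       vanish k l || vanish (i + k) l && vanish k (i + l)) ->
  vanish i j.
Proof.
move=> i0 j1 van; apply/mulvP => a c Va.
apply: (@memv_linear_dpow (mul a)) => // k l k0 l0 klj w z Vw Vz.
have /orP[/mulvP vkl | /andP[/mulvP vl /mulvP vr]] := van k l k0 l0 klj.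
  by rewrite -addnS; apply: mem_mul_dpow => //; rewrite -klj; apply: vkl.
change (mul a (mul w z) \in V (i + j).+1); rewrite pre_lie_mulA.
rewrite -klj; apply: rpredD; first apply: rpredB.
- by rewrite addnA; apply: vl => //; apply: mem_mul_dpow.
- by rewrite addnA; apply: vl => //; rewrite addnC; apply: mem_mul_dpow.
- by rewrite addnCA; apply: vr => //; apply: mem_mul_dpow.
Qed.

(** This is the case of [vanish_pre_lie] where the products vanish for lack of
    degrees i + k and i + l, both of which lie strictly between i and i + j. *)
Lemma vanish_gap i j : (0 < i)%N -> (1 < j)%N ->
  (forall k, (0 < k)%N -> (k < j)%N -> ~~ jump (i + k)) -> vanish i j.
Proof.
move=> i0 j1 gap; apply: vanish_pre_lie => // k l k0 l0 klj.
rewrite (@vanish_njumpl (i + k)) ?(@vanish_njumpr k (i + l)) ?orbT //; try lia.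
- by apply: gap; lia.
- by apply: gap; lia.
Qed.

(** * The possible sets of jumps in dimension five *)

(** Without degree 3 only the product of degrees 2 + 2 could reach degree 4, and
    it vanishes by the gap at 3. *)
Lemma njump4_of_njump3 : ~~ jump 3 -> ~~ jump 4.
Proof.
move=> nj3; apply: vanish_njump => // i j i0 j0 ij ji jj.
have neq3 n : jump n -> n <> 3%N by move=> jn n3; rewrite n3 (negPf nj3) in jn.
have [-> ->] : i = 2%N /\ j = 2%N by move/neq3: ji; move/neq3: jj; lia.
by apply: vanish_gap => // k k0 lt_k2; have -> : k = 1%N by lia.
Qed.

(** Without degrees 4 and 5 only the product of degrees 3 + 3 could reach degree
    6, and it vanishes by the gap at 4 and 5. *)
Lemma njump6_of_njump45 : ~~ jump 4 -> ~~ jump 5 -> ~~ jump 6.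
Proof.
move=> nj4 nj5; apply: vanish_njump => // i j i0 j0 ij ji jj.
have neq45 n : jump n -> n <> 4%N /\ n <> 5%N.
  by move=> jn; split=> n45; move: jn; rewrite n45 ?(negPf nj4) ?(negPf nj5).
have [-> ->] : i = 3%N /\ j = 3%N by move/neq45: ji; move/neq45: jj; lia.
apply: vanish_gap => // k k0 lt_k3.
by have [-> | ->] : k = 1%N \/ k = 2%N by lia.
Qed.

(** Five jumps are forced, and there is no room for a sixth one. *)
Lemma jumps_of_jump_ge8 m : (\dim {:A} <= 5)%N -> (8 <= m)%N -> jump m ->
  exists2 q, q \in [:: 4; 5]%N &
    forall n, jump n -> n \in [:: 1; 2; 3; q; m]%N.
Proof.
move=> dimA m8 jm.
have between q : (1 < q)%N -> (q <= 8)%N -> has jump (iota q q.-1).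
  by move=> q1 q8; apply: jump_between jm; lia.
have j2 : jump 2 by have := between 2%N isT isT; rewrite /= orbF.
have j3 : jump 3.
  have := between 3%N isT isT; rewrite /= orbF.
  by apply: contraTT => nj3; rewrite negb_or nj3 njump4_of_njump3.
have [q q45 jq] : exists2 q, q \in [:: 4; 5]%N & jump q.
  have := between 4%N isT isT; rewrite /= orbF.
  case: (boolP (jump 4)) => [j4 _ | nj4]; first by exists 4%N.
  case: (boolP (jump 5)) => [j5 _ | nj5]; first by exists 5%N.
  by rewrite (negPf (njump6_of_njump45 nj4 nj5)).
exists q => // n; apply: contraTT => n_notin; apply/negP => jn.
suff: (size [:: n; 1; 2; 3; q; m]%N <= 5)%N by [].
apply: leq_trans dimA; apply: size_jumps.
  by rewrite cons_uniq n_notin /= !inE; rewrite !inE in q45; lia.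
by rewrite /= jn (jump1_of_jump2 j2) j2 j3 jq jm.
Qed.

Theorem dpow8_eq0 : nilpotent_mul mul -> (\dim {:A} <= 5)%N -> V 8 = 0%VS.
Proof.
move=> mul_nilp dimA.
have [// | [m m8 jm]] := @dpow_eq0_or_jump 8 mul_nilp isT; exfalso.
have [q q45 all_jumps] := jumps_of_jump_ge8 dimA m8 jm.
have nj n : n \notin [:: 1; 2; 3; q; m]%N -> ~~ jump n.
  exact: contra (all_jumps n).
move: jm; apply/negP/vanish_njump => [|i j i0 j0 ijm]; first by lia.
move=> /all_jumps i_in /all_jumps j_in; move: q45 i_in j_in; rewrite !inE.
case/orP=> /eqP q_eq; subst q => i_in j_in.
  have [-> ->] : i = 4%N /\ j = 4%N by lia.
  by apply: vanish_gap => // k k0 lt_k4; apply: nj; rewrite !inE; lia.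
have [[i5 j5] | [[i5 j3] | [i3 j5]]] : (i = 5 /\ j = 5)%N \/
    (i = 5 /\ j = 3)%N \/ (i = 3 /\ j = 5)%N by lia.
- rewrite i5 j5; apply: vanish_gap => // k k0 lt_k5.
  by apply: nj; rewrite !inE; lia.
- rewrite i5 j3; apply: vanish_gap => // k k0 lt_k3.
  by apply: nj; rewrite !inE; lia.
(* The gap argument fails for 3 + 5, as 5 itself lies between 3 and 8: the
   decompositions k + l of 5 are considered separately. *)
rewrite i3 j5; apply: vanish_pre_lie => // k l k0 l0 kl.
have nj4 : ~~ jump 4 by apply: nj; rewrite !inE; lia.
have [k1 | [k2 | [k3 | k4]]] : k = 1%N \/ k = 2%N \/ k = 3%N \/ k = 4%N by lia.
- have -> : l = 4%N by lia.
  by rewrite k1 vanish_njumpr.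
- have -> : l = 3%N by lia.
  rewrite k2; apply/orP; right; apply/andP; split.
    by apply: vanish_gap => // k' k'0 lt_k'3; apply: nj; rewrite !inE; lia.
  by apply: vanish_njumpr => //; apply: nj; rewrite !inE; lia.
- have -> : l = 2%N by lia.
  rewrite k3 vanish_gap // => k' k'0 lt_k'2.
  by have -> : k' = 1%N by lia.
- by rewrite k4 vanish_njumpl.
Qed.

End PreLie.
End DescendingPowers.

Theorem theorem3p1p1 (p : nat) (p_prime : prime p) (A : vectType 'F_p)
    (mul : {bilinear A -> A -> A}) (mul_pre_lie : pre_lie mul)
    (mul_nilp : nilpotent_mul mul)
    (cardA : #|{: finvect_type A}| = (p ^ 5)%N) :
  dpow mul 8 = 0%VS.
Proof.
apply: dpow8_eq0 => //.
have /eqP : (p ^ \dim {:A})%N = (p ^ 5)%N.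
  rewrite -cardA -(@card_vspacef _ (finvect_type A) (Vector.class A)).
  by rewrite card_vspace card_Fp.
by rewrite eqn_exp2l ?prime_gt1 // => /eqP->.
Qed.
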